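(* Let $n\ge2$ and let $X_{\cdot,B}$ be a simple (undirected, loopless) quantum graph on $M_n$, i.e. $B\in M_n$ is a real symmetric projector with $B\mathbf 1=0$. Then $\omega(X_{\cdot,B})\le\sqrt{\operatorname{rk}B+1}$.
   Context: $M_n=M_n(\mathbb C)$; ''projector'' means orthogonal projector; $\mathbf 1\in\mathbb C^n$ is the all-ones vector. $X_{\cdot,B}$ is the quantum graph on $M_n$ with adjacency operator the Schur multiplier $x\mapsto (B_{ij}x_{ij})_{i,j}$; its operator space is $S=\{\operatorname{diag}(v): v\in\operatorname{img}B\}\subseteq M_n$. A $k$-clique of a quantum graph with operator space $S$ is a projector $P\in M_n$ of rank $k$ such that $P(S\oplus\mathbb CI)P=PM_nP$; equivalently, an isometry $V\colon\mathbb C^k\to\mathbb C^n$ with $V^\dagger(S\oplus\mathbb CI)V=M_k$. The clique number $\omega$ is the largest $k$ for which a $k$-clique exists. *)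

(* Defs.v *)
From HB Require Import structures.
From mathcomp Require Import all_boot all_order all_algebra.
From mathcomp Require Export complex.
From mathcomp Require Import boolp reals.

Set Implicit Arguments.
Unset Strict Implicit.
Unset Printing Implicit Defensive.

Import Order.TTheory GRing.Theory Num.Theory.
Local Open Scope ring_scope.

Section QuantumGraph.
Variables (R : realType) (n : nat).
Local Notation C := R[i].
Implicit Types (B P x : 'M[C]_n) (S : {vspace 'M[C]_n}) (k : nat).

Definition projector P := P *m P = P /\ P \is hermsymmx.

(* The simplicity conditions on X_{.,B}; \col_(i < n) 1 is the all-ones vector. *)
Definition simple_schur B :=
  [/\ projector B, B \is symmetricmx, B \is a realmx
    & B *m (\col_(i < n) 1) = 0].

Definition schur_multiplier B : 'M[C]_n -> 'M[C]_n :=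
  fun x => \matrix_(i, j) (B i j * x i j).

Definition diag_cV (v : 'cV[C]_n) : 'M[C]_n := diag_mx v^T.

Lemma diag_cV_is_linear : linear diag_cV.
Proof. by move=> a u v; rewrite /diag_cV !linearP. Qed.
HB.instance Definition _ := GRing.isLinear.Build C _ _ _ diag_cV diag_cV_is_linear.

(* {diag v : v in img B}, with B acting on column vectors. *)
Definition schur_opspace B : {vspace 'M[C]_n} :=
  (linfun diag_cV @: limg (linfun (mulmx B : 'cV[C]_n -> 'cV[C]_n)))%VS.

Definition compression P : 'M[C]_n -> 'M[C]_n := fun x => P *m x *m P.

Lemma compression_is_linear P : linear (compression P).
Proof.
by move=> a u v; rewrite /compression mulmxDr mulmxDl -scalemxAr -scalemxAl.
Qed.
HB.instance Definition _ P :=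
  GRing.isLinear.Build C _ _ _ (compression P) (compression_is_linear P).

(* P (S + C I) P = P M_n P. *)
Definition clique S k P :=
  [/\ projector P, \rank P = k
    & (linfun (compression P) @: (S + <[1%:M]>) =
       linfun (compression P) @: fullv)%VS].

Definition has_clique S k := exists P, clique S k P.

(* The largest k with a k-clique: by has_clique0 and has_clique_le below, the
   maximum ranges over a nonempty set of sizes that contains all of them. *)
Definition clique_number S : nat := \max_(k < n.+1 | `[< has_clique S k >]) k.

Lemma has_clique0 S : has_clique S 0.
Proof.
exists 0; split.
- split; first by rewrite mulmx0.
  by apply/is_hermitianmxP; rewrite trmx0 map_mx0 scaler0.
- exact: mxrank0.
- suff -> : linfun (compression 0) = 0 by rewrite !lim0g.
  by apply/lfunP => x; rewrite lfunE /= lfunE /compression !mul0mx.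
Qed.

Lemma has_clique_le S k : has_clique S k -> (k <= n)%N.
Proof. by case=> P [_ <- _]; exact: rank_leq_row. Qed.

Lemma clique_numberP S :
  has_clique S (clique_number S) /\
  forall k, has_clique S k -> (k <= clique_number S)%N.
Proof.
split=> [|k hk]; last first.
  have kn : (k < n.+1)%N by rewrite ltnS (has_clique_le hk).
  by apply: (leq_bigmax_cond (Ordinal kn)); apply/asboolP.
rewrite /clique_number; elim/big_ind: _ => [|a b ha hb|i /asboolP //].
  exact: has_clique0.
by rewrite /maxn; case: ifP.
Qed.

Lemma mem_schur_opspace B x :
  x \in schur_opspace B <-> exists v : 'cV[C]_n, x = diag_mx (B *m v)^T.
Proof.
split=> [/memv_imgP [w /memv_imgP [v _ ->] ->]|[v ->]].
  by exists v; rewrite !lfunE.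
rewrite -[diag_mx _]/(diag_cV _) -[diag_cV _]lfunE -[B *m v]lfunE.
by rewrite !memv_img ?memvf.
Qed.

(* The operator space is the one spanned by the Kraus operators of the
   adjacency operator A = schur_multiplier B, that is, the range of the Choi
   matrix of A: if A x = \sum_a K_a x K_a^*, then
   (A (delta_mx i j)) k l = \sum_a (K_a) k i * ((K_a) l j)^*. *)
Lemma schur_opspace_choi B x :
  x \in schur_opspace B <->
  exists c : 'M[C]_n, forall k i : 'I_n,
    x k i = \sum_l \sum_j schur_multiplier B (delta_mx i j) k l * c l j.
Proof.
have choiE (c : 'M[C]_n) (k i : 'I_n) :
    \sum_l \sum_j schur_multiplier B (delta_mx i j) k l * c l j =
    (diag_mx (B *m \col_j c j j)^T) k i.
  rewrite !mxE -sumrMnl; apply: eq_bigr => l _.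
  rewrite (bigD1 l) //= big1 => [|j jl].
    by rewrite !mxE eqxx andbT addr0; case: (k == i);
       rewrite ?mulr1 ?mulr0 ?mul0r ?mulr1n ?mulr0n.
  by rewrite !mxE [l == j]eq_sym (negbTE jl) andbF mulr0 mul0r.
split=> [/mem_schur_opspace [v ->]|[c xE]].
  exists (diag_cV v) => k i; rewrite choiE; congr ((diag_mx (B *m _)^T) k i).
  by apply/colP => j; rewrite !mxE eqxx mulr1n.
apply/mem_schur_opspace; exists (\col_j c j j).
by apply/matrixP => k i; rewrite xE choiE.
Qed.

End QuantumGraph.

(* Main.v *)
Require Import Defs.
From mathcomp Require Import all_boot all_order all_algebra.
From mathcomp Require Import complex boolp reals.

Import Order.TTheory GRing.Theory Num.Theory.
Local Open Scope ring_scope.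

(** A k-clique P compresses S + C I onto P M_n P, which is isomorphic to M_k and
    so has dimension k^2. As S is the image of img B under v |-> diag v, the
    dimension of S + C I is at most rk B + 1, whence k^2 <= rk B + 1. *)

Lemma dim_limg_le (F : fieldType) (U V : vectType F) (f : 'Hom(U, V))
    (W : {vspace U}) : (\dim (f @: W) <= \dim W)%N.
Proof. by rewrite -[leqRHS](limg_ker_dim f W) leq_addl. Qed.

(** As [A = col_base A *m row_base A], the image of [A] lies in that of [col_base A], whose source
    has dimension [\rank A]. *)
Lemma dim_limg_mulmx (F : fieldType) (m n : nat) (A : 'M[F]_(m, n)) :
  (\dim (limg (linfun (mulmx A : 'cV_n -> 'cV_m))) <= \rank A)%N.
Proof.
pose g := linfun (mulmx (col_base A) : 'cV_(\rank A) -> 'cV_m).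
have sub : (limg (linfun (mulmx A : 'cV_n -> 'cV_m)) <= limg g)%VS.
  apply/subvP => _ /memv_imgP [v _ ->]; apply/memv_imgP.
  exists (row_base A *m v); first exact: memvf.
  by rewrite !lfunE /= mulmxA mulmx_base.
apply: leq_trans (dimvS sub) (leq_trans (dim_limg_le _ _ _ _ _) _).
by rewrite dimvf dim_matrix [leqLHS]muln1.
Qed.

(** With [l] a left inverse of [col_base P] and [r] a right inverse of [row_base P], the product is
    [l *m P *m P *m r]; idempotence leaves [l *m P *m r = row_base P *m r]. *)
Lemma row_base_mul_col_base (F : fieldType) (n : nat) (P : 'M[F]_n) :
  P *m P = P -> row_base P *m col_base P = 1%:M.
Proof.
move=> PP.
have /row_freeP [r rP] := row_base_free P.
have /row_fullP [l lP] := col_base_full P.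
have lP_row : l *m P = row_base P.
  by rewrite -[X in l *m X]mulmx_base mulmxA lP mul1mx.
have Pr_col : P *m r = col_base P.
  by rewrite -[X in X *m r]mulmx_base -mulmxA rP mulmx1.
by rewrite -Pr_col -[X in X *m _]lP_row mulmxA -(mulmxA l) PP lP_row.
Qed.

(* With P = C *m L a rank factorization, L *m C = 1, so x |-> L *m x *m C maps
   P M_n P onto M_k. *)
Lemma dim_compression (R : realType) (n : nat) (P : 'M[R[i]]_n) :
  P *m P = P ->
  (\rank P ^ 2 <= \dim (linfun (compression P) @: fullv))%N.
Proof.
move=> PP; have RC := row_base_mul_col_base _ _ _ PP.
have RP : row_base P *m P = row_base P.
  by rewrite -[X in _ *m X]mulmx_base mulmxA RC mul1mx.
have PC : P *m col_base P = col_base P.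
  by rewrite -[X in X *m _]mulmx_base -mulmxA RC mulmx1.
(* Generalized because rewriting with mulmxA would unfold the two bases. *)
move: (row_base P) (col_base P) RC RP PC => L C LC LP PC.
pose h := (linfun (mulmxr C : 'M_(\rank P, n) -> 'M_(\rank P))
  \o linfun (mulmx L : 'M_n -> 'M_(\rank P, n)))%VF.
apply: leq_trans (dim_limg_le _ _ _ h _).
suff -> : (h @: (linfun (compression P) @: fullv) = fullv)%VS.
  by rewrite dimvf dim_matrix.
apply/vspaceP => Y; rewrite memvf.
have -> : Y = h (linfun (compression P) (C *m Y *m L)).
  rewrite lfunE /= !lfunE /= /compression !mulmxA LP LC mul1mx.
  by rewrite -!mulmxA PC LC mulmx1.
by rewrite !memv_img ?memvf.
Qed.

Lemma clique_sqr_le (R : realType) (n : nat) (B : 'M[R[i]]_n) (k : nat) :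
  has_clique (schur_opspace B) k -> (k ^ 2 <= (\rank B).+1)%N.
Proof.
case=> P [[PP _] <- SP]; apply: leq_trans (dim_compression _ _ _ PP) _.
rewrite -SP; apply: leq_trans (dim_limg_le _ _ _ _ _) _.
apply: leq_trans (dimv_add_leqif _ _) _.
(* The extra 1 bounds the dimension of the scalar line, which [dim_vline] gives as a truth value. *)
rewrite -addn1; apply: leq_add; last by rewrite dim_vline leq_b1.
exact: leq_trans (dim_limg_le _ _ _ _ _) (dim_limg_mulmx _ _ _ _).
Qed.

Theorem proposition4p39 (R : realType) (n : nat) (B : 'M[R[i]]_n) :
  (2 <= n)%N -> simple_schur B ->
  (clique_number (schur_opspace B))%:R <= Num.sqrt ((\rank B)%:R + 1 : R).
Proof.
move=> _ _; have [/clique_sqr_le le_k _] := clique_numberP (schur_opspace B).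
(* Writing the clique number as the root of its square reduces the claim to the bound on squares. *)
rewrite -[leLHS]ger0_norm ?ler0n // -sqrtr_sqr ler_wsqrtr //.
by rewrite -natrX natr1 ler_nat.
Qed.
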